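(* Let $\lambda\in\mathbb{R}$, let $a,a^{+}$ be boson operators, i.e. linear operators on a complex vector space with $aa^{+}-a^{+}a=1$, and let $\hat{n}=a^{+}a$. For all integers $k,r$ with $k\ge r\ge 0$, $$(a^{+})^{k}a^{k}=\sum_{m=0}^{k}(-1)^{k-m}{k+r \brack m+r}_{r,\lambda}(\hat{n}+r)_{m,\lambda}$$ and $$(a^{+})^{k-r}a^{k-r}=\sum_{m=r}^{k}(-1)^{k-m}{k \brack m}_{r,\lambda}(\hat{n}+r)_{m-r,\lambda}.$$
   Context: The boson annihilation and creation operators $a$, $a^{+}$ satisfy $[a,a^{+}]=aa^{+}-a^{+}a=1$ (the identity operator); they can be realized for instance by $a=\frac{d}{dx}$ and $a^{+}=x$ (multiplication by $x$). The operator $\hat n=a^{+}a$ is the number operator. For $\lambda\in\mathbb{R}$ and $y$ a number, indeterminate or operator, $(y)_{0,\lambda}=1$ and $(y)_{n,\lambda}=y(y-\lambda)(y-2\lambda)\cdots(y-(n-1)\lambda)$ for $n\ge 1$ (for operators, scalars stand for scalar multiples of the identity). Further $\langle y\rangle_{0}=1$, $\langle y\rangle_{n}=y(y+1)\cdots(y+n-1)$ for $n\ge1$, and $\langle y\rangle_{n,\lambda}=(-1)^{n}(-y)_{n,\lambda}$, i.e. $\langle y\rangle_{0,\lambda}=1$ and $\langle y\rangle_{n,\lambda}=y(y+\lambda)\cdots(y+(n-1)\lambda)$ for $n\ge 1$. For an integer $r\ge 0$, the unsigned degenerate $r$-Stirling numbers of the first kind ${n+r \brack k+r}_{r,\lambda}$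 ($0\le k\le n$) are defined by the polynomial identity $$\langle y+r\rangle_{n}=\sum_{k=0}^{n}{n+r \brack k+r}_{r,\lambda}\langle y\rangle_{k,\lambda}\quad (n\ge 0).$$ In particular, for $k\ge m\ge r$, ${k\brack m}_{r,\lambda}$ means ${(k-r)+r\brack (m-r)+r}_{r,\lambda}$. *)

(* Defs.v *)
From HB Require Import structures.
From mathcomp Require Import all_boot all_order all_algebra complex.
From mathcomp Require Import boolp functions reals.
Set Implicit Arguments.
Unset Strict Implicit.
Unset Printing Implicit Defensive.
Import Order.TTheory GRing.Theory Num.Theory.
Local Open Scope ring_scope.
Local Open Scope complex_scope.

(* y (y + lam) ... (y + (n-1) lam); the ordinary rising factorial of y is the
   case lam = 1. *)
Definition dg_rising (R : comNzRingType) (lam : R) (y : {poly R}) (n : nat)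
    : {poly R} :=
  \prod_(i < n) (y + (i%:R * lam)%:P).

(* The indices of S are the two entries of the bracket, which are therefore
   both at least r in the defining identity; S is unconstrained elsewhere. *)
Definition is_dg_rstirling1 (R : comNzRingType) (lam : R) (r : nat)
    (S : nat -> nat -> R) : Prop :=
  forall n : nat,
    dg_rising 1 ('X + r%:R%:P) n =
    \sum_(0 <= k < n.+1) S (n + r)%N (k + r)%N *: dg_rising lam 'X k.

Lemma is_dg_rstirling1_exists (R : comNzRingType) (lam : R) (r : nat) :
  exists S, is_dg_rstirling1 lam r S.
Proof.
pose fix c n k {struct n} : R :=
  match n, k with
  | 0, 0 => 1
  | 0, _.+1 => 0
  | n'.+1, 0 => (n' + r)%:R * c n' 0%N
  | n'.+1, k'.+1 => c n' k' + ((n' + r)%:R - k'.+1%:R * lam) * c n' k'.+1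
  end.
have c0 n k : (n < k)%N -> c n k = 0.
  elim: n k => [|n IHn] [|k] //= ltnk; rewrite !IHn ?mulr0 ?addr0 //.
  exact: ltnW.
exists (fun N M => c (N - r)%N (M - r)%N); elim=> [|n IHn].
  by rewrite big_nat1 !addnK /dg_rising !big_ord0 scale1r.
rewrite {1}/dg_rising big_ord_recr -/(dg_rising _ _ _) /= {}IHn.
under [in RHS]eq_bigr do rewrite /= !addnK.
under [in LHS]eq_bigr do rewrite /= !addnK.
rewrite mulr_suml mulr1 -addrA -polyCD -natrD.
have step k : c n k *: dg_rising lam 'X k * ('X + (r + n)%:R%:P) =
    c n k *: dg_rising lam 'X k.+1
    + (((n + r)%:R - k%:R * lam) * c n k) *: dg_rising lam 'X k.
  rewrite /dg_rising big_ord_recr /= -/(dg_rising _ _ _) [(r + n)%N]addnC.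
  rewrite [_ * c n k]mulrC -scalerA -scalerDr -scalerAl; congr (_ *: _).
  rewrite -mul_polyC [_%:P * dg_rising _ _ _]mulrC -mulrDr; congr (_ * _).
  by rewrite polyCB -addrA; congr (_ + _); rewrite addrC subrK.
under [in LHS]eq_bigr do rewrite step.
rewrite big_split /= [RHS]big_nat_recl //=.
under [in RHS]eq_bigr do rewrite scalerDl.
rewrite big_split /= addrCA; congr (_ + _).
rewrite big_nat_recl //= mul0r subr0; congr (_ + _).
by rewrite [RHS]big_nat_recr //= c0 // mulr0 scale0r addr0.
Qed.

Lemma is_dg_rstirling1_unique (R : comNzRingType) (lam : R) (r : nat)
    (S S' : nat -> nat -> R) :
  is_dg_rstirling1 lam r S -> is_dg_rstirling1 lam r S' ->
  forall n k, (k <= n)%N -> S (n + r)%N (k + r)%N = S' (n + r)%N (k + r)%N.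
Proof.
move=> defS defS' n k; rewrite -ltnS.
have monic_size m : dg_rising lam 'X m \is monic /\
    size (dg_rising lam 'X m : {poly R}) = m.+1.
  elim: m => [|m [mon sz]]; first by rewrite /dg_rising big_ord0 size_poly1 monic1.
  rewrite /dg_rising big_ord_recr /= -/(dg_rising _ _ _).
  have -> : 'X + (m%:R * lam)%:P = 'X - (- (m%:R * lam))%:P :> {poly R}.
    by rewrite polyCN opprK.
  rewrite monicMl ?monicXsubC // size_monicM ?polyXsubC_eq0 ?sz //.
    by rewrite size_XsubC addn2.
have := etrans (esym (defS n)) (defS' n).
pose u j := S (n + r)%N (j + r)%N; pose v j := S' (n + r)%N (j + r)%N.
rewrite -/(u k) -/(v k).
change (\sum_(0 <= i < n.+1) u i *: dg_rising lam 'X i =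
        \sum_(0 <= i < n.+1) v i *: dg_rising lam 'X i ->
        (k < n.+1)%N -> u k = v k).
move: u v => u v; move: n.+1 => m {n defS defS'}; elim: m k => // m IHm k.
rewrite !big_nat_recr //= => eq_uv.
have coef0 w : (\sum_(0 <= i < m) w i *: dg_rising lam 'X i : {poly R})`_m = 0.
  rewrite coef_sum big_nat big1 // => i /andP[_ ltim].
  by rewrite coefZ nth_default ?mulr0 // (monic_size i).2.
have [mon sz] := monic_size m.
have coef1 : (dg_rising lam 'X m : {poly R})`_m = 1.
  by rewrite -(monicP mon) lead_coefE sz.
have um : u m = v m.
  have /(congr1 (fun p : {poly R} => p`_m)) := eq_uv.
  by rewrite !coefD !coef0 !coefZ coef1 !mulr1 !add0r.
rewrite ltnS leq_eqVlt => /predU1P[->//|ltkm].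
by apply: IHm ltkm; move: eq_uv; rewrite um => /addIr.
Qed.

(* dg_rstirling1 lam r N M is the bracket [N M]_{r,lam}, for N >= M >= r. *)
Definition dg_rstirling1 (R : comNzRingType) (lam : R) (r : nat)
    : nat -> nat -> R :=
  sval (cid (is_dg_rstirling1_exists lam r)).

Lemma dg_rstirling1P (R : comNzRingType) (lam : R) (r : nat) :
  is_dg_rstirling1 lam r (dg_rstirling1 lam r).
Proof. exact: (svalP (cid (is_dg_rstirling1_exists lam r))). Qed.

(* T (T - lam) ... (T - (n-1) lam) for an operator T: the product is
   composition and a scalar c stands for c times the identity. *)
Definition op_dg_falling (K : pzRingType) (V : lmodType K) (lam : K)
    (T : V -> V) (n : nat) : V -> V :=
  \big[comp/idfun]_(i < n) (T - (i%:R * lam) *: (idfun : V -> V)).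

Definition number_op (V : Type) (a ap : V -> V) : V -> V := ap \o a.

(* Main.v *)
Require Import Defs.
From HB Require Import structures.
From mathcomp Require Import all_boot all_order all_algebra complex.
From mathcomp Require Import boolp functions reals.
Set Implicit Arguments.
Unset Strict Implicit.
Unset Printing Implicit Defensive.
Import Order.TTheory GRing.Theory Num.Theory.
Local Open Scope ring_scope.
Local Open Scope complex_scope.

(** Substituting [y = - X - r] in the identity defining the brackets and
    clearing signs gives
    [X (X - 1) ... (X - k + 1) =
     \sum_m (-1) ^ (k - m) [k + r, m + r] (X + r)_{m, lam}].
    Evaluating [X] at the number operator turns the left-hand side into
    [ap ^ k a ^ k], because [a ap ^ k = ap ^ k a + k ap ^ (k - 1)]. *)

Section PolyEvaluation.
Variables (K : comNzRingType) (V : lmodType K) (T : {linear V -> V}).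
Implicit Types (x : V) (p q : {poly K}).

(** The vector [p(T) x]; fixing [x] first lets linearity in [p] be registered for [poly_op x]. *)
Definition poly_op x p : V := \sum_(i < size p) p`_i *: iter i T x.

(** Padding with zero coefficients gives polynomials of different sizes a common summation range. *)
Lemma poly_opE n x p : (size p <= n)%N ->
  poly_op x p = \sum_(i < n) p`_i *: iter i T x.
Proof.
move=> le_pn; rewrite /poly_op (big_ord_widen _ (fun i => p`_i *: iter i T x) le_pn).
rewrite big_mkcond; apply: eq_bigr => i _.
by case: ltnP => // le_pi; rewrite nth_default // scale0r.
Qed.

Lemma poly_op_is_linear x : linear (poly_op x).
Proof.
move=> c p q; pose n := maxn (size p) (size q).
have le_n : (size (c *: p + q)%R <= n)%N.
  apply: leq_trans (size_polyD _ _) _.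
  by rewrite geq_max leq_maxr (leq_trans (size_scale_leq _ _) (leq_maxl _ _)).
rewrite (poly_opE _ le_n) (poly_opE _ (leq_maxl _ _ : size p <= n)%N).
rewrite (poly_opE _ (leq_maxr _ _ : size q <= n)%N) scaler_sumr -big_split.
by apply: eq_bigr => i _; rewrite coefD coefZ scalerDl scalerA.
Qed.

HB.instance Definition _ x :=
  GRing.isLinear.Build K {poly K} V _ (poly_op x) (poly_op_is_linear x).

Lemma poly_op1 x : poly_op x 1 = x.
Proof. by rewrite /poly_op size_poly1 big_ord1 coef1 scale1r. Qed.

Lemma poly_opMX x p : poly_op x (p * 'X) = T (poly_op x p).
Proof.
have le_n : (size (p * 'X)%R <= (size p).+1)%N.
  by rewrite (leq_trans (size_polyMleq _ _)) // size_polyX addn2.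
rewrite (poly_opE _ le_n) big_ord_recl coefMX scale0r add0r /poly_op linear_sum.
by apply: eq_bigr => i _; rewrite coefMX linearZ.
Qed.

Lemma poly_opMXaddC x p c :
  poly_op x (p * ('X + c%:P)) = T (poly_op x p) + c *: poly_op x p.
Proof. by rewrite mulrDr linearD /= poly_opMX mulrC mul_polyC linearZ. Qed.

Lemma op_dg_falling_shift lam c n x :
  op_dg_falling lam ((T : V -> V) + c *: (idfun : V -> V)) n x =
  poly_op x (\prod_(i < n) ('X + (c - i%:R * lam)%:P)).
Proof.
rewrite /op_dg_falling.
(* The offsets become an arbitrary sequence: peeling off the outermost factor shifts the index, so
   the induction hypothesis is needed at [d i.+1]. *)
pose d i := i%:R * lam.
under eq_bigr do rewrite -/(d _).
under [in RHS]eq_bigr do rewrite -/(d _).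
elim: n d => [|n IHn] d; first by rewrite !big_ord0 poly_op1.
rewrite !big_ord_recl /= (IHn (fun i => d i.+1)).
by rewrite [in RHS]mulrC poly_opMXaddC scalerBl addrA.
Qed.

End PolyEvaluation.

Section BosonNormalOrdering.
Variables (K : comNzRingType) (V : lmodType K) (a ap : {linear V -> V}).
Hypothesis boson : (a \o ap) - (ap \o a) = idfun :> (V -> V).

(** The extra [ap] on the left avoids the exponent [k - 1], so [k = 0] is an ordinary base case. *)
Lemma boson_iter k x :
  ap (a (iter k ap x)) = iter k.+1 ap (a x) + k%:R *: iter k ap x.
Proof.
have comm y : a (ap y) = ap (a y) + y.
  have /(congr1 (fun f => f y)) := boson; rewrite [LHS]/= => /eqP.
  by rewrite subr_eq addrC => /eqP.
elim: k => [|k IHk]; first by rewrite scale0r addr0.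
rewrite iterS comm IHk !linearD linearZ /= -addrA; congr (_ + _).
by rewrite -[k.+1]addn1 natrD scalerDl scale1r.
Qed.

Lemma normal_order_falling k x :
  iter k ap (iter k a x) =
  poly_op (ap \o a) x (\prod_(i < k) ('X - i%:R%:P)).
Proof.
elim: k => [|k IHk]; first by rewrite big_ord0 poly_op1.
(* The new factor acts as [ap a - k], and [boson_iter] turns [(ap a - k) ap ^ k a ^ k] into
   [ap ^ (k + 1) a ^ (k + 1)]. *)
rewrite big_ord_recr /= -polyCN poly_opMXaddC -IHk /= boson_iter.
by rewrite -addrA -scalerDl subrr scale0r addr0.
Qed.

End BosonNormalOrdering.

(** Needed because the brackets are real while the operators act on a complex space; mapping
    coefficients preserves the defining identity. *)
Lemma is_dg_rstirling1_map (R K : comNzRingType) (f : {rmorphism R -> K})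
    (lam : R) (r : nat) (S : nat -> nat -> R) :
  is_dg_rstirling1 lam r S ->
  is_dg_rstirling1 (f lam) r (fun n k => f (S n k)).
Proof.
have map_rising mu (p : {poly R}) n :
    map_poly f (dg_rising mu p n) = dg_rising (f mu) (map_poly f p) n.
  rewrite rmorph_prod; apply: eq_bigr => i _.
  by rewrite rmorphD /= map_polyC /= rmorphM rmorph_nat.
move=> defS n; have /(congr1 (map_poly f)) := defS n.
rewrite map_rising rmorph1 rmorphD /= map_polyX map_polyC /= rmorph_nat => ->.
rewrite rmorph_sum; apply: eq_bigr => k _.
by rewrite /= map_polyZ map_rising map_polyX.
Qed.

Lemma falling_dg_rstirling1 (K : comNzRingType) (lam : K) (r : nat)
    (S : nat -> nat -> K) (n : nat) :
  is_dg_rstirling1 lam r S ->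
  \prod_(i < n) ('X - i%:R%:P) =
  \sum_(0 <= k < n.+1) ((-1) ^+ (n - k) * S (n + r)%N (k + r)%N) *:
    \prod_(i < k) ('X + (r%:R - i%:R * lam)%:P).
Proof.
have comp_rising mu (p q : {poly K}) m :
    dg_rising mu p m \Po q = dg_rising mu (p \Po q) m.
  rewrite /dg_rising rmorph_prod; apply: eq_bigr => i _.
  by rewrite /= comp_polyD comp_polyC.
have risingN mu (p : {poly K}) m :
    dg_rising mu (- p) m = (-1) ^+ m * \prod_(i < m) (p - (i%:R * mu)%:P).
  rewrite -[m in X in X * _]card_ord -prodrN; apply: eq_bigr => i _.
  by rewrite opprB addrC.
(* This substitution sends [X + r] to [- X], so the left-hand side becomes [(-1) ^ n] times the
   falling factorial of [X]. *)
move=> /(_ n) /(congr1 (fun p => p \Po (- ('X + r%:R%:P)))).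
rewrite comp_rising comp_polyD comp_polyX comp_polyC opprD subrK risingN.
move/(congr1 ( *%R ((-1) ^+ n))); rewrite mulrA -expr2 sqrr_sign mul1r.
under eq_bigr do rewrite mulr1.
move=> ->; rewrite linear_sum mulr_sumr big_nat [RHS]big_nat.
apply: eq_bigr => k /andP[_ le_kn].
rewrite /= comp_polyZ comp_rising comp_polyX -opprD risingN.
(* [n + k] and the truncated [n - k] have the same parity since [k <= n]. *)
have eq_sign : (-1) ^+ n * (-1) ^+ k = ((-1) ^+ (n - k))%:P :> {poly K}.
  by rewrite -exprD -signr_odd oddD -oddB // signr_odd rmorph_sign.
rewrite -scalerAr mulrA eq_sign mul_polyC scalerA mulrC; congr (_ *: _).
by apply: eq_bigr => i _; rewrite polyCB addrA.
Qed.

Lemma normal_order_dg_rstirling1 (K : comNzRingType) (V : lmodType K)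
    (a ap : {linear V -> V})
    (boson : (a \o ap) - (ap \o a) = idfun :> (V -> V))
    (lam : K) (r : nat) (S : nat -> nat -> K) (k : nat) :
  is_dg_rstirling1 lam r S ->
  iter k ap \o iter k a =
  \sum_(0 <= m < k.+1) ((-1) ^+ (k - m) * S (k + r)%N (m + r)%N) *:
    op_dg_falling lam (number_op a ap + r%:R *: (idfun : V -> V)) m
  :> (V -> V).
Proof.
move=> defS; apply/funext => x.
rewrite /= (normal_order_falling boson) (falling_dg_rstirling1 k defS).
rewrite linear_sum fct_sumE; apply: eq_bigr => m _.
by rewrite linearZ /= -op_dg_falling_shift.
Qed.

Theorem theorem4 (R : realType) (lam : R) (V : lmodType R[i])
    (a ap : {linear V -> V})
    (boson : (a \o ap) - (ap \o a) = idfun :> (V -> V))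
    (k r : nat) (hkr : (r <= k)%N) :
  (iter k ap \o iter k a =
   \sum_(0 <= m < k.+1)
     ((-1) ^+ (k - m) * (dg_rstirling1 lam r (k + r) (m + r))%:C) *:
     op_dg_falling lam%:C
       (number_op a ap + r%:R *: (idfun : V -> V)) m :> (V -> V))
  /\
  (iter (k - r) ap \o iter (k - r) a =
   \sum_(r <= m < k.+1)
     ((-1) ^+ (k - m) * (dg_rstirling1 lam r k m)%:C) *:
     op_dg_falling lam%:C
       (number_op a ap + r%:R *: (idfun : V -> V)) (m - r) :> (V -> V)).
Proof.
have order n := normal_order_dg_rstirling1 boson n
  (is_dg_rstirling1_map (real_complex R) (dg_rstirling1P lam r)).
split; first exact: order.
(* The second formula is the first at [k - r], with the summation index shifted by [r]. *)
rewrite order subnK // -[X in _ = \sum_(X <= _ < _) _]add0n big_addn subSn //.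
by apply: eq_bigr => m _; rewrite addnK subnAC -subnDA.
Qed.
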